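(* Let $\Omega\subseteq\mathbb{F}$ be a P-closed set with P-bases $\mathcal{A},\mathcal{B}$, $n=\mathrm{Rk}(\Omega)$. Let $a^{(1)},\dots,a^{(\ell)}\in\mathbb{F}$ lie in pairwise distinct conjugacy classes such that $\mathcal{A}_i=\mathcal{A}\cap C(a^{(i)})$ and $\mathcal{B}_i=\mathcal{B}\cap C(a^{(i)})$ are non-empty for each $i$ and $\mathcal{A}=\bigcup_i\mathcal{A}_i$, $\mathcal{B}=\bigcup_i\mathcal{B}_i$. Then $\#\mathcal{A}_i=\#\mathcal{B}_i=:n_i$ and $n=n_1+\dots+n_\ell$. Write $\mathcal{A}_i=\{a^{(i)}_1,\dots,a^{(i)}_{n_i}\}$, $\mathcal{B}_i=\{b^{(i)}_1,\dots,b^{(i)}_{n_i}\}$ and pick $\alpha^{(i)}_j,\beta^{(i)}_j\in\mathbb{F}^*$ with $a^{(i)}_j=\mathcal{D}_{a^{(i)}}(\alpha^{(i)}_j)(\alpha^{(i)}_j)^{-1}$ and $b^{(i)}_j=\mathcal{D}_{a^{(i)}}(\beta^{(i)}_j)(\beta^{(i)}_j)^{-1}$. Define $\phi_\mathcal{A}:\mathbb{F}^\mathcal{A}\to\mathbb{F}^n$ by $\phi_\mathcal{A}(f)=(\mathbf{c}^{(1)},\dots,\mathbf{c}^{(\ell)})$, $\mathbf{c}^{(i)}\in\mathbb{F}^{n_i}$, $c^{(i)}_j=F^{\mathcal{D}_{a^{(i)}}}(\alpha^{(i)}_j)$, where $F\in\mathbb{F}[x;\sigma,\delta]_n$ is the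 unique polynomial with $E_\mathcal{A}(F)=f$; define $\phi_\mathcal{B}$ analogously using the $\beta^{(i)}_j$. Then for each $i$ there is an invertible $M_i\in K_{a^{(i)}}^{n_i\times n_i}$ with $(\beta^{(i)}_1,\dots,\beta^{(i)}_{n_i})=(\alpha^{(i)}_1,\dots,\alpha^{(i)}_{n_i})M_i$; letting $M=\mathrm{diag}(M_1,\dots,M_\ell)$ and $\pi_M(\mathbf{c})=\mathbf{c}M$, the maps $\phi_\mathcal{A},\phi_\mathcal{B},\pi_{\mathcal{A},\mathcal{B}},\pi_M$ are left vector space isomorphisms and $\phi_\mathcal{B}\circ\pi_{\mathcal{A},\mathcal{B}}=\pi_M\circ\phi_\mathcal{A}$.
   Context: $\mathbb{F}$ is a division ring, $\sigma$ a ring endomorphism, $\delta$ a $\sigma$-derivation ($\delta$ additive, $\delta(ab)=\sigma(a)\delta(b)+\delta(a)b$); $\mathbb{F}[x;\sigma,\delta]$ the skew polynomial ring (left $\mathbb{F}$-space with basis $x^i$, $xa=\sigma(a)x+\delta(a)$), $\mathbb{F}[x;\sigma,\delta]_n$ the elements of degree $<n$; evaluation $F(a)$ defined by $F-F(a)\in\mathbb{F}[x;\sigma,\delta](x-a)$, $E_\mathcal{A}(F)=(a\mapsto F(a))\in\mathbb{F}^\mathcal{A}$. P-closure $\overline\Omega$ is the common zero set of all skew polynomials vanishing on $\Omega$; P-closed, P-independent (no element in the P-closure of the others), P-basis (P-independent subset whose P-closure is $\Omega$); $\mathrm{Rk}(\Omega)$ the common size of P-bases; $E_\mathcal{A}$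 is a bijection $\mathbb{F}[x;\sigma,\delta]_n\to\mathbb{F}^\mathcal{A}$. $\pi_{\mathcal{A},\mathcal{B}}(E_\mathcal{A}(F))=E_\mathcal{B}(F)$. For $a\in\mathbb{F}$: $\mathcal{D}_a(b)=\sigma(b)a+\delta(b)$, $\mathcal{D}_a^i$ its $i$-fold composition ($\mathcal{D}_a^0=\mathrm{Id}$); for $F=\sum_iF_ix^i$, $F^{\mathcal{D}_a}(b)=\sum_iF_i\mathcal{D}_a^i(b)$; $K_a=\{b:\mathcal{D}_a(b)=ab\}$ (a division subring); $C(a)=\{\mathcal{D}_a(b)b^{-1}:b\in\mathbb{F}^*\}$. *)

(* Defs.v *)
(* Skew polynomials over a division ring F, represented as
   {poly F} used ONLY as the left F-vector space with basis x^i
   (p = sum_i p`_i x^i); the skew multiplication is defined explicitly below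
   (the commutative multiplication of {poly F} is only used for the shift
   'X * p, i.e. right multiplication by x). *)
From HB Require Import structures.
From mathcomp Require Import all_boot all_order all_algebra.
From Stdlib Require Import ClassicalEpsilon ClassicalDescription.

Unset Strict Implicit.
Unset Printing Implicit Defensive.
Import GRing.Theory.
Local Open Scope ring_scope.

Section Skew.
Variable F : unitRingType.
Variable sigma : F -> F.
Variable delta : F -> F.

(* left multiplication by x : x * (sum c_k x^k) = sum (sigma c_k x^(k+1) + delta c_k x^k) *)
Definition skew_mulX (p : {poly F}) : {poly F} :=
  'X * map_poly sigma p + map_poly delta p.

(* right multiplication by a constant : p * c = sum_i p_i (x^i c) *)
Definition skew_mulC (p : {poly F}) (c : F) : {poly F} :=
  \sum_(i < size p) p`_i *: iter i skew_mulX c%:P.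

Definition skew_mulXr (p : {poly F}) : {poly F} := 'X * p.

(* p - c lies in the left ideal F[x;sigma,delta] (x - a) *)
Definition skew_rem_rel (p : {poly F}) (a c : F) : Prop :=
  exists q : {poly F}, p = skew_mulXr q - skew_mulC q a + c%:P.

(* evaluation F(a): the (unique) c with F - c in F[x;sigma,delta](x - a) *)
Definition skew_eval (p : {poly F}) (a : F) : F :=
  @epsilon F (inhabits 0) (fun c => skew_rem_rel p a c).

Definition P_closure (S : F -> Prop) (a : F) : Prop :=
  forall p : {poly F}, (forall b, S b -> skew_eval p b = 0) -> skew_eval p a = 0.

Definition P_closed (S : F -> Prop) : Prop := forall a, P_closure S a <-> S a.

Definition P_independent (A : seq F) : Prop :=
  uniq A /\ forall x, x \in A -> ~ P_closure (fun y => y \in A /\ y <> x) x.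

Definition P_basis (S : F -> Prop) (A : seq F) : Prop :=
  [/\ forall x, x \in A -> S x, P_independent A &
      forall a, P_closure (fun y => y \in A) a <-> S a].

Definition Dop (a b : F) : F := sigma b * a + delta b.

Definition inC (x a : F) : Prop := exists b : F, b != 0 /\ x = Dop a b * b^-1.
Definition inCb (x a : F) : bool :=
  if excluded_middle_informative (inC x a) then true else false.

Definition inK (a b : F) : Prop := Dop a b = a * b.

Definition skew_Deval (p : {poly F}) (a b : F) : F :=
  \sum_(i < size p) p`_i * iter i (Dop a) b.

(* E_A(F) in F^A; F^A is indexed by positions in the (duplicate-free) seq A *)
Definition EvalOn (A : seq F) (p : {poly F}) : {ffun 'I_(size A) -> F} :=
  [ffun k : 'I_(size A) => skew_eval p (nth 0 A k)].

Definition Interp (A : seq F) (n : nat) (f : {ffun 'I_(size A) -> F}) : {poly F} :=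
  @epsilon {poly F} (inhabits 0) (fun p => (size p <= n)%N /\ EvalOn A p = f).

Definition piAB (A B : seq F) (n : nat) (f : {ffun 'I_(size A) -> F})
  : {ffun 'I_(size B) -> F} := EvalOn B (Interp A n f).

Definition nnum (A : seq F) (l : nat) (a : 'I_l -> F) (i : 'I_l) : nat :=
  count (fun x => inCb x (a i)) A.

Definition part (A : seq F) (l : nat) (a : 'I_l -> F) (i : 'I_l) : seq F :=
  filter (fun x => inCb x (a i)) A.

(* F^n, with coordinates indexed by the pairs (i, j), j < n_i *)
Definition phiMap (A : seq F) (n l : nat) (a : 'I_l -> F) (nn : 'I_l -> nat)
  (alpha : forall i : 'I_l, 'I_(nn i) -> F) (f : {ffun 'I_(size A) -> F})
  : {ffun {i : 'I_l & 'I_(nn i)} -> F} :=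
  [ffun ij => skew_Deval (Interp A n f) (a (tag ij)) (alpha (tag ij) (tagged ij))].

Definition piM (l : nat) (nn : 'I_l -> nat) (M : forall i : 'I_l, 'M[F]_(nn i))
  (c : {ffun {i : 'I_l & 'I_(nn i)} -> F}) : {ffun {i : 'I_l & 'I_(nn i)} -> F} :=
  [ffun ij => \sum_(j < nn (tag ij))
      c (existT (fun i => 'I_(nn i)) (tag ij) j) * M (tag ij) j (tagged ij)].

Definition left_linear (X Y : finType) (f : {ffun X -> F} -> {ffun Y -> F}) : Prop :=
  forall (c : F) (u v : {ffun X -> F}),
    f [ffun x => c * u x + v x] = [ffun y => c * f u y + f v y].

Definition left_iso (X Y : finType) (f : {ffun X -> F} -> {ffun Y -> F}) : Prop :=
  left_linear X Y f /\ bijective f.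

End Skew.

Arguments skew_mulX {F} sigma delta p.
Arguments skew_mulC {F} sigma delta p c.
Arguments skew_mulXr {F} p.
Arguments skew_rem_rel {F} sigma delta p a c.
Arguments skew_eval {F} sigma delta p a.
Arguments P_closure {F} sigma delta S a.
Arguments P_closed {F} sigma delta S.
Arguments P_independent {F} sigma delta A.
Arguments P_basis {F} sigma delta S A.
Arguments Dop {F} sigma delta a b.
Arguments inC {F} sigma delta x a.
Arguments inCb {F} sigma delta x a.
Arguments inK {F} sigma delta a b.
Arguments skew_Deval {F} sigma delta p a b.
Arguments EvalOn {F} sigma delta A p.
Arguments Interp {F} sigma delta A n f.
Arguments piAB {F} sigma delta A B n f.
Arguments nnum {F} sigma delta A {l} a i.
Arguments part {F} sigma delta A {l} a i.
Arguments phiMap {F} sigma delta A n {l} a {nn} alpha f.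
Arguments piM {F l nn} M c.
Arguments left_linear {F X Y} f.
Arguments left_iso {F X Y} f.

(* Main.v *)
(** For nonzero [b], evaluation at the conjugate [D_a(b) b^-1] is given by
    [F^(D_a)(b) = F(D_a(b) b^-1) b], so up to the nonzero factors [alpha] the map
    [phi_A] is evaluation on [A].  If [b] represents a point of the P-closure of
    [A], then [F^(D_(a i))(b)] is a left linear combination of the values
    [F^(D_(a i'))(alpha i' j)], with right coefficients [mu] independent of [F];
    replacing [F] by [x F] gives [D_(a i)(mu) = a i' * mu].  Hence [mu = 0]
    outside the class of [a i], and [mu] lies in [K_(a i)] inside it, which yields
    the matrices [M i].  Polynomials dual to [A] show that the [alpha i j] are
    right independent over [K_(a i)]; so the transition matrices for [(A, B)] and
    [(B, A)] are mutually inverse and have the same size.  Right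
    [K_(a i)]-linearity of [F^(D_(a i))] gives the commuting square. *)
Require Import Defs.
From HB Require Import structures.
From mathcomp Require Import all_boot all_order all_algebra.
From Stdlib Require Import ClassicalEpsilon ClassicalDescription.
Import GRing.Theory.
Local Open Scope ring_scope.

(** * Left linear algebra over a division ring *)

Section DivisionRingLinearAlgebra.

Context (F : unitRingType).
Context (F_div : forall x : F, x != 0 -> x \is a GRing.unit).

Lemma divring_mulf_eq0 (x y : F) : x * y = 0 -> y != 0 -> x = 0.
Proof. by move=> xy0 /F_div Uy; rewrite -[x](mulrK Uy) xy0 mul0r. Qed.

(** Gaussian elimination on the first column. Left multiples [q] of a pivot row [r] clear that
    column in the other rows; a relation [v] among the reduced rows lifts by giving row [r] the
    coefficient that collects the subtracted multiples. A zero column is simply dropped. *)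
Lemma rows_dependent {m n} (A : 'I_m -> 'I_n -> F) : (n < m)%N ->
  exists v : 'I_m -> F, (exists i, v i != 0) /\ forall j, \sum_i v i * A i j = 0.
Proof.
elim: n m A => [|n IHn] [|m] A //= lt_nm.
  by exists (fun=> 1); split=> [|[]//]; exists ord0; apply: oner_neq0.
have [[r Ar0]|A0] : (exists r, A r ord0 != 0) \/ (forall r, A r ord0 = 0).
- have [[r Ar0]|nA0] := altP (@existsP _ (fun r => A r ord0 != 0)).
    by left; exists r.
  right.
  by move=> r; apply/eqP; apply: contraNT nA0 => nz; apply/existsP; exists r.
- pose q i := A (lift r i) ord0 / A r ord0.
  have [v [[i vi] vA]] :=
    IHn m (fun i j => A (lift r i) (lift ord0 j) - q i * A r (lift ord0 j)) lt_nm.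
  exists (fun i => if unlift r i is Some k then v k else - \sum_k v k * q k).
  split=> [|j]; first by exists (lift r i); rewrite liftK.
  rewrite (bigD1_ord r) //= unlift_none; set c := \sum_k v k * q k.
  rewrite (eq_bigr (fun k => v k * A (lift r k) j)) => [|k _]; last by rewrite liftK.
  rewrite {}/c mulNr mulr_suml; case: (unliftP ord0 j) => [k ->|->].
    apply/eqP; rewrite addrC subr_eq0 -subr_eq0 -sumrB -[X in _ == X](vA k).
    by apply/eqP; apply: eq_bigr => i' _; rewrite /q mulrBr !mulrA.
  apply/eqP; rewrite addrC subr_eq0; apply/eqP; apply: eq_bigr => k _.
  by rewrite -mulrA mulrVK ?F_div.
have [v [nzv vA]] := IHn m.+1 (fun i j => A i (lift ord0 j)) (ltnW lt_nm).
exists v; split=> // j; case: (unliftP ord0 j) => [k ->|->]; first exact: vA.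
by rewrite big1 // => i _; rewrite A0 mulr0.
Qed.

(** If [n < m], a nonzero row [w] with [w *m M = 0] exists, but [w = w *m M *m N]. *)
Lemma mulmx1_leq {m n} (M : 'M[F]_(m, n)) (N : 'M[F]_(n, m)) :
  M *m N = 1%:M -> (m <= n)%N.
Proof.
move=> MN1; rewrite leqNgt; apply/negP => /(rows_dependent M)[v [[i /eqP vi0] vM]].
pose w : 'rV[F]_m := \row_i v i.
have wM : w *m M = 0.
  by apply/rowP=> j; rewrite !mxE -[RHS](vM j); apply: eq_bigr => k _; rewrite mxE.
have w0 : w = 0 by rewrite -[w]mulmx1 -MN1 mulmxA wM mul0mx.
by apply: vi0; move/rowP/(_ i): w0; rewrite !mxE.
Qed.

End DivisionRingLinearAlgebra.

(** * The operators [Dop], operator evaluation and skew multiplication *)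

Section SkewEvaluation.

Context (F : unitRingType).
Context (F_div : forall x : F, x != 0 -> x \is a GRing.unit).
Context (sigma : {rmorphism F -> F}) (delta : F -> F).
Context (delta_add : forall x y : F, delta (x + y) = delta x + delta y).
Context (delta_mul : forall x y : F, delta (x * y) = sigma x * delta y + delta x * y).

Local Notation D := (Dop sigma delta).
Local Notation Deval := (skew_Deval sigma delta).
Local Notation eval := (skew_eval sigma delta).
Local Notation mulX := (skew_mulX sigma delta).
Local Notation mulC := (skew_mulC sigma delta).

Lemma delta0 : delta 0 = 0.
Proof. by apply: (addrI (delta 0)); rewrite -delta_add !addr0. Qed.

Lemma delta1 : delta 1 = 0.
Proof.
by apply: (addrI (delta 1)); rewrite addr0 -{3}[1]mulr1 delta_mul rmorph1 mul1r mulr1.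
Qed.

Lemma DopD a x y : D a (x + y) = D a x + D a y.
Proof. by rewrite /Dop rmorphD mulrDl delta_add addrACA. Qed.

Lemma Dop0 a : D a 0 = 0.
Proof. by rewrite /Dop rmorph0 mul0r add0r delta0. Qed.

Lemma Dop1 a : D a 1 = a.
Proof. by rewrite /Dop rmorph1 mul1r delta1 addr0. Qed.

Lemma DopM a x y : D a (x * y) = sigma x * D a y + delta x * y.
Proof. by rewrite /Dop rmorphM delta_mul mulrDr !mulrA addrA. Qed.

Lemma Dop_sum a I (r : seq I) (G : I -> F) :
  D a (\sum_(i <- r) G i) = \sum_(i <- r) D a (G i).
Proof. exact: (big_morph (D a) (DopD a) (Dop0 a)). Qed.

Lemma DopMK a b k : inK sigma delta a k -> D a (b * k) = D a b * k.
Proof. by move=> Kk; rewrite DopM Kk /Dop mulrDl !mulrA. Qed.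

Lemma iter_DopD a n x y : iter n (D a) (x + y) = iter n (D a) x + iter n (D a) y.
Proof. by elim: n => //= n ->; rewrite DopD. Qed.

Lemma iter_Dop0 a n : iter n (D a) 0 = 0.
Proof. by elim: n => //= n ->; rewrite Dop0. Qed.

Lemma iter_DopMK a b k n : inK sigma delta a k ->
  iter n (D a) (b * k) = iter n (D a) b * k.
Proof. by move=> Kk; elim: n => //= n ->; rewrite DopMK. Qed.

Lemma Deval_widen n (p : {poly F}) a b : (size p <= n)%N ->
  Deval p a b = \sum_(i < n) p`_i * iter i (D a) b.
Proof.
move=> le_pn; rewrite /skew_Deval [RHS](bigID (fun i : 'I_n => (i < size p)%N)) /=.
rewrite (big_ord_widen n (fun i => p`_i * iter i (D a) b)) // [X in _ + X]big1 ?addr0 //.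
by move=> i; rewrite -leqNgt => /(nth_default 0) ->; rewrite mul0r.
Qed.

Lemma DevalD (p q : {poly F}) a b : Deval (p + q) a b = Deval p a b + Deval q a b.
Proof.
rewrite !(@Deval_widen (maxn (size p) (size q))) ?leq_maxl ?leq_maxr ?size_polyD //.
by rewrite -big_split; apply: eq_bigr => i _; rewrite coefD mulrDl.
Qed.

Lemma DevalZ c p a b : Deval (c *: p) a b = c * Deval p a b.
Proof.
rewrite (@Deval_widen (size p)) ?size_scale_leq // mulr_sumr.
by apply: eq_bigr => i _; rewrite coefZ mulrA.
Qed.

Lemma Deval0 a b : Deval 0 a b = 0.
Proof. by rewrite /skew_Deval size_poly0 big_ord0. Qed.

Lemma DevalN p a b : Deval (- p) a b = - Deval p a b.
Proof. by rewrite -scaleN1r DevalZ mulN1r. Qed.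

Lemma Deval_sum I (r : seq I) (P : I -> {poly F}) a b :
  Deval (\sum_(i <- r) P i) a b = \sum_(i <- r) Deval (P i) a b.
Proof.
apply: (big_morph (fun p => Deval p a b)) => [p q|]; [exact: DevalD | exact: Deval0].
Qed.

Lemma DevalC c a b : Deval c%:P a b = c * b.
Proof. by rewrite (@Deval_widen 1) ?size_polyC_leq1 // big_ord1 coefC. Qed.

Lemma DevalDr p a x y : Deval p a (x + y) = Deval p a x + Deval p a y.
Proof. by rewrite -big_split; apply: eq_bigr => i _; rewrite iter_DopD mulrDr. Qed.

Lemma Deval0r p a : Deval p a 0 = 0.
Proof. by rewrite /skew_Deval big1 // => i _; rewrite iter_Dop0 mulr0. Qed.

Lemma Deval_sumr p a I (r : seq I) (G : I -> F) :
  Deval p a (\sum_(i <- r) G i) = \sum_(i <- r) Deval p a (G i).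
Proof. exact: (big_morph (Deval p a) (DevalDr p a) (Deval0r p a)). Qed.

Lemma DevalMK p a b k : inK sigma delta a k -> Deval p a (b * k) = Deval p a b * k.
Proof.
by move=> Kk; rewrite mulr_suml; apply: eq_bigr => i _; rewrite iter_DopMK ?mulrA.
Qed.

Lemma size_mulX_leq (p : {poly F}) : (size (mulX p) <= (size p).+1)%N.
Proof.
apply/leq_sizeP => j lt_pj; rewrite coefD coefXM !coef_map_id0 ?rmorph0 ?delta0 //.
rewrite [p`_j]nth_default ?delta0 ?addr0 ?(ltnW lt_pj) //.
by case: j lt_pj => //= j lt_pj; rewrite nth_default ?rmorph0.
Qed.

Lemma lead_coef_mulX p : (mulX p)`_(size p) = sigma (lead_coef p).
Proof.
rewrite coefD coefXM !coef_map_id0 ?rmorph0 ?delta0 //.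
rewrite [p`_(size p)]nth_default // delta0 addr0 lead_coefE.
by case: eqP => // p0; rewrite nth_default ?rmorph0 ?p0.
Qed.

Lemma Deval_mulX p a b : Deval (mulX p) a b = D a (Deval p a b).
Proof.
rewrite (Deval_widen _ _ _ _ (size_mulX_leq p)) Dop_sum big_ord_recl /=.
under [in RHS]eq_bigr do rewrite DopM.
rewrite big_split /= coefD coefXM add0r coef_map_id0 ?delta0 //.
under eq_bigr do rewrite coefD coefXM /= !coef_map_id0 ?rmorph0 ?delta0 // mulrDl.
rewrite big_split /= addrCA; congr (_ + _).
rewrite -(@big_ord_recl _ _ _ _ (fun i => delta p`_i * iter i (D a) b)).
by rewrite big_ord_recr /= nth_default // delta0 mul0r addr0.
Qed.

Lemma Deval_mulXr p a b : Deval (skew_mulXr p) a b = Deval p a (D a b).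
Proof.
rewrite (@Deval_widen (size p).+1); last first.
  by apply/leq_sizeP => [[|j]] // lt_pj; rewrite coefXM /= nth_default.
rewrite big_ord_recl coefXM mul0r add0r.
by apply: eq_bigr => i _; rewrite coefXM /= -iterSr.
Qed.

(** With [Deval_mulXr], this shows that right factors act on the argument, so operator evaluation
    turns skew products by x and by constants into compositions. *)
Lemma Deval_mulC p c a b : Deval (mulC p c) a b = Deval p a (c * b).
Proof.
rewrite /skew_mulC Deval_sum; apply: eq_bigr => i _; rewrite DevalZ; congr (_ * _).
by elim: (i : nat) => [|k IHk] /=; rewrite ?DevalC // Deval_mulX IHk.
Qed.

(** * Right division by x - a, and evaluation at conjugates *)

Lemma mulC_widen n (p : {poly F}) c : (size p <= n)%N ->
  mulC p c = \sum_(i < n) p`_i *: iter i mulX c%:P.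
Proof.
move=> le_pn; rewrite /skew_mulC [RHS](bigID (fun i : 'I_n => (i < size p)%N)) /=.
rewrite (big_ord_widen n (fun i => p`_i *: iter i mulX c%:P)) //.
rewrite [X in _ + X]big1 ?addr0 // => i.
by rewrite -leqNgt => /(nth_default 0) ->; rewrite scale0r.
Qed.

Lemma mulCD p q c : mulC (p + q) c = mulC p c + mulC q c.
Proof.
rewrite !(@mulC_widen (maxn (size p) (size q))) ?leq_maxl ?leq_maxr ?size_polyD //.
by rewrite -big_split; apply: eq_bigr => i _; rewrite coefD scalerDl.
Qed.

Lemma size_iter_mulX_leq (p : {poly F}) n : (size (iter n mulX p) <= size p + n)%N.
Proof.
elim: n => [|n IHn] /=; first by rewrite addn0.
by rewrite (leq_trans (size_mulX_leq _)) // addnS ltnS.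
Qed.

Lemma size_mulC_leq (p : {poly F}) c : (size (mulC p c) <= size p)%N.
Proof.
apply: (leq_trans (size_sum _ _ _)); apply/bigmax_leqP => i _.
apply: (leq_trans (size_scale_leq _ _)); apply: (leq_trans (size_iter_mulX_leq _ _)).
by rewrite (leq_trans _ (ltn_ord i)) // -[X in (_ <= X)%N]add1n leq_add2r size_polyC_leq1.
Qed.

(** Writing p = p1 x + p_0 = p1 (x - a) + (p1 a + p_0), the last bracket is of smaller size, and its
    own quotient [q] is added to p1. *)
Lemma skew_rem_exists p a : exists c, skew_rem_rel sigma delta p a c.
Proof.
have [n le_pn] := ubnP (size p); elim: n p le_pn => // n IHn p le_pn.
have [/size1_polyC ->|gt_p1] := leqP (size p) 1.
  exists p`_0, 0.
  by rewrite /skew_mulXr mulr0 /skew_mulC size_poly0 big_ord0 subr0 add0r.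
have def_p : p = skew_mulXr (drop_poly 1 p) + (p`_0)%:P.
  apply/polyP=> i; rewrite coefD coefXM coefC coef_drop_poly.
  by case: i => [|i]; rewrite /= ?add0r // addr0 addn1.
pose p1 := drop_poly 1 p.
have lt_p1 : (size p1 < size p)%N.
  by rewrite size_drop_poly subn1 ltn_predL (ltn_trans _ gt_p1).
have [|c [q def_c]] := IHn (mulC p1 a + (p`_0)%:P).
  apply: leq_trans (ltnSE le_pn).
  apply: (leq_ltn_trans (size_polyD _ _)); rewrite gtn_max.
  by rewrite (leq_ltn_trans (size_mulC_leq _ _) lt_p1) (leq_ltn_trans (size_polyC_leq1 _)).
exists c, (p1 + q); rewrite mulCD /skew_mulXr mulrDr {1}def_p.
rewrite -/(skew_mulXr p1) -/(skew_mulXr q) opprD addrACA -[RHS]addrA -def_c.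
by rewrite addrA subrK.
Qed.

(** For a' = D_a(b) b^-1 one has D_a(b) = a' b, so every left multiple of x - a' sends [b] to 0;
    only the constant remainder contributes. *)
Lemma skew_eval_conj p a b : b != 0 -> Deval p a b = eval p (D a b * b^-1) * b.
Proof.
move=> nz_b; have Ub := F_div b nz_b.
have [q] := epsilon_spec (inhabits 0) _ (skew_rem_exists p (D a b * b^-1)).
rewrite -/(eval p _) => def_p.
rewrite [in LHS]def_p DevalD DevalD DevalN Deval_mulXr Deval_mulC mulrVK //.
by rewrite subrr add0r DevalC.
Qed.

(** The case b = 1, where D_a(1) = a, trades the choice operator for an explicit sum; left linearity
    of evaluation follows. *)
Lemma skew_evalE p a : eval p a = Deval p a 1.
Proof. by rewrite skew_eval_conj ?oner_neq0 // Dop1 divr1 mulr1. Qed.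

(** * Linearity of evaluation and interpolation on P-independent sets *)

Lemma skew_evalD p q a : eval (p + q) a = eval p a + eval q a.
Proof. by rewrite !skew_evalE DevalD. Qed.

Lemma skew_evalZ c p a : eval (c *: p) a = c * eval p a.
Proof. by rewrite !skew_evalE DevalZ. Qed.

Lemma skew_eval_sum I (r : seq I) (P : I -> {poly F}) a :
  eval (\sum_(i <- r) P i) a = \sum_(i <- r) eval (P i) a.
Proof. by rewrite skew_evalE Deval_sum; apply: eq_bigr => i _; rewrite skew_evalE. Qed.

Lemma skew_evalN p a : eval (- p) a = - eval p a.
Proof. by rewrite !skew_evalE DevalN. Qed.

(** The leading coefficient is a unit and [sigma] preserves units, so it never vanishes under [mulX]
    and the degree grows by exactly one. *)
Lemma size_iter_mulX (p : {poly F}) k : p != 0 ->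
  size (iter k mulX p) = (size p + k)%N.
Proof.
move=> nz_p; elim: k => [|k IHk] /=; first by rewrite addn0.
have nz_k : iter k mulX p != 0 by rewrite -size_poly_gt0 IHk addn_gt0 size_poly_gt0 nz_p.
apply/eqP; rewrite eqn_leq addnS -IHk size_mulX_leq ltnNge /=; apply/negP.
move=> /leq_sizeP/(_ _ (leqnn _)); rewrite lead_coef_mulX => l0.
have Ul : lead_coef (iter k mulX p) \is a GRing.unit by rewrite F_div ?lead_coef_eq0.
by have := rmorph_unit sigma Ul; rewrite l0 unitr0.
Qed.

(** There is one more monomial than there are points, so the value vectors of the monomials are left
    dependent; the relation gives the coefficients of [g]. *)
Lemma vanishing_poly (S : seq F) : exists2 g : {poly F},
  (g != 0) && (size g <= (size S).+1)%N & forall x, x \in S -> eval g x = 0.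
Proof.
have [v [[i nz_vi] v0]] := rows_dependent F F_div
  (fun (i : 'I_(size S).+1) (j : 'I_(size S)) => eval 'X^i S`_j) (ltnSn _).
pose g : {poly F} := \poly_(i < (size S).+1) v (inord i).
exists g; rewrite ?size_poly ?andbT.
  apply: contraNneq nz_vi => g0; have := coef_poly (size S).+1 (fun i => v (inord i)) i.
  by rewrite ltn_ord inord_val => <-; rewrite -/g g0 coef0.
move=> x /(nthP 0)[j lt_jS <-]; rewrite /g poly_def skew_eval_sum.
rewrite -[RHS](v0 (Ordinal lt_jS)); apply: eq_bigr => k _.
by rewrite inord_val skew_evalZ.
Qed.

(* Right division by a nonzero [g] of degree at most [size S] vanishing on [S]. *)
Lemma reduce_degree (S : seq F) (p : {poly F}) : exists2 r : {poly F},
  (size r <= size S)%N & forall x, x \in S -> eval r x = eval p x.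
Proof.
have [g /andP[nz_g le_g] g0] := vanishing_poly S.
have [n le_pn] := ubnP (size p); elim: n p le_pn => // n IHn p le_pn.
have [|lt_Sp] := leqP (size p) (size S); first by exists p.
(* The left multiple x^k g has the size of [p] and still vanishes on [S], so cancelling the leading
   term of [p] with it keeps the values on [S]. *)
pose k := (size p - size g)%N; pose h := iter k mulX g.
have size_h : size h = size p by rewrite size_iter_mulX // subnKC // (leq_trans le_g).
have nz_p : p != 0 by rewrite -size_poly_gt0 (leq_trans _ lt_Sp).
have Uh : lead_coef h \is a GRing.unit.
  by rewrite F_div // lead_coef_eq0 -size_poly_gt0 size_h size_poly_gt0.
have h0 x : x \in S -> eval h x = 0.
  move=> /g0; rewrite !skew_evalE /h => gx0.
  by elim: (k) => //= i IHi; rewrite Deval_mulX IHi Dop0.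
have [|r le_rS r_p] := IHn (p - (lead_coef p / lead_coef h) *: h).
  apply: leq_trans (ltnSE le_pn); rewrite [size p]polySpred // ltnS.
  apply/leq_sizeP => j; rewrite leq_eqVlt coefB coefZ => /predU1P[<-|lt_pj].
    by rewrite -lead_coefE -size_h -lead_coefE mulrVK ?subrr.
  rewrite !nth_default ?mulr0 ?subr0 ?size_h //; first by rewrite -polySpred in lt_pj.
  by rewrite -polySpred in lt_pj.
exists r => // x Sx; rewrite r_p // skew_evalD skew_evalN skew_evalZ h0 //.
by rewrite mulr0 subr0.
Qed.

(** Otherwise every polynomial vanishing on the rest of [S] would vanish at [x], putting [x] in the
    P-closure of the rest. *)
Lemma P_dual (S : seq F) x : P_independent sigma delta S -> x \in S ->
  exists q : {poly F}, eval q x = 1 /\ forall y, y \in S -> y <> x -> eval q y = 0.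
Proof.
move=> [_ indS] Sx; apply: NNPP => no_q; apply: (indS x Sx) => p p0.
apply: NNPP => /eqP px; apply: no_q; exists ((eval p x)^-1 *: p).
split=> [|y Sy xy]; first by rewrite skew_evalZ mulVr ?F_div.
by rewrite skew_evalZ (p0 y) ?mulr0.
Qed.

(** Lagrange interpolation with the dual polynomials, followed by a reduction of the degree. *)
Lemma EvalOn_surjective (S : seq F) f : P_independent sigma delta S ->
  exists p : {poly F}, (size p <= size S)%N /\ EvalOn sigma delta S p = f.
Proof.
move=> indS; have uS := proj1 indS.
have [q qP] := fin_all_exists (fun k : 'I_(size S) =>
  P_dual S (nth 0 S k) indS (mem_nth 0 (ltn_ord k))).
have [p le_p pE] := reduce_degree S (\sum_k f k *: q k).
exists p; split=> //; apply/ffunP=> k; rewrite ffunE pE ?mem_nth //.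
rewrite skew_eval_sum (bigD1 k) //= skew_evalZ (proj1 (qP k)) mulr1.
rewrite big1 ?addr0 // => j ne_jk; rewrite skew_evalZ (proj2 (qP j)) ?mulr0 ?mem_nth //.
by apply/eqP; rewrite nth_uniq // eq_sym.
Qed.

Lemma InterpK (S : seq F) n f : P_independent sigma delta S -> n = size S ->
  EvalOn sigma delta S (Interp sigma delta S n f) = f.
Proof.
by move=> indS ->; have [] := epsilon_spec (inhabits 0) _ (EvalOn_surjective S f indS).
Qed.

Lemma EvalOn_linear (S : seq F) c (p q : {poly F}) :
  EvalOn sigma delta S (c *: p + q) =
  [ffun k => c * EvalOn sigma delta S p k + EvalOn sigma delta S q k].
Proof. by apply/ffunP=> k; rewrite !ffunE skew_evalD skew_evalZ. Qed.

(** The difference vanishes on [S], hence on its P-closure [Omega], which contains [T]. So in [piAB]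
    any polynomial with the right values on [S] may replace the chosen interpolant. *)
Lemma EvalOn_transfer (Omega : F -> Prop) (S T : seq F) (p q : {poly F}) :
  P_basis sigma delta Omega S -> P_basis sigma delta Omega T ->
  EvalOn sigma delta S p = EvalOn sigma delta S q ->
  EvalOn sigma delta T p = EvalOn sigma delta T q.
Proof.
move=> [_ _ clS] [subT _ _] eq_pq; apply/ffunP=> k; rewrite !ffunE.
have /clS/(_ (p - q)) := subT _ (mem_nth 0 (ltn_ord k)).
rewrite skew_evalD skew_evalN => pq0; apply/eqP; rewrite -subr_eq0 pq0 //.
move=> _ /(nthP 0)[j lt_jS <-]; move/ffunP/(_ (Ordinal lt_jS)): eq_pq.
by rewrite !ffunE /= skew_evalD skew_evalN => ->; rewrite subrr.
Qed.

Lemma piAB_iso (Omega : F -> Prop) (S T : seq F) n :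
  P_basis sigma delta Omega S -> P_basis sigma delta Omega T ->
  n = size S -> n = size T -> left_iso (piAB sigma delta S T n).
Proof.
move=> bS bT nS nT; have [[_ indS _] [_ indT _]] := (bS, bT); split=> [c u v|].
  rewrite /piAB -EvalOn_linear; apply: (EvalOn_transfer Omega S) => //.
  by rewrite InterpK // EvalOn_linear !InterpK.
exists (piAB sigma delta T S n) => f.
  rewrite -[RHS](InterpK S n) //; apply: (EvalOn_transfer Omega T) => //.
  by rewrite InterpK.
rewrite -[RHS](InterpK T n) //; apply: (EvalOn_transfer Omega S) => //.
by rewrite InterpK.
Qed.

(** * The subrings K_a and conjugacy as an equivalence relation *)

Lemma inK1 a : inK sigma delta a 1.
Proof. by rewrite /inK Dop1 mulr1. Qed.

Lemma inK0 a : inK sigma delta a 0.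
Proof. by rewrite /inK Dop0 mulr0. Qed.

Lemma inKD a x y : inK sigma delta a x -> inK sigma delta a y -> inK sigma delta a (x + y).
Proof. by rewrite /inK DopD mulrDr => -> ->. Qed.

Lemma inKM a x y : inK sigma delta a x -> inK sigma delta a y -> inK sigma delta a (x * y).
Proof. by move=> Kx Ky; rewrite /inK DopMK // Kx mulrA. Qed.

Lemma inKN a x : inK sigma delta a x -> inK sigma delta a (- x).
Proof.
move=> Kx; apply: (addIr (D a x)).
by rewrite -DopD addNr Dop0 Kx -mulrDr addNr mulr0.
Qed.

Lemma inCP x a : reflect (inC sigma delta x a) (inCb sigma delta x a).
Proof. by rewrite /inCb; case: (excluded_middle_informative _) => ?; constructor. Qed.

Lemma inC_refl a : inC sigma delta a a.
Proof. by exists 1; rewrite oner_neq0 Dop1 divr1. Qed.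

(** If y = D_z(b) b^-1, the product rule gives D_z(c b) (c b)^-1 = D_y(c) c^-1, so conjugators
    multiply. *)
Lemma inC_trans x y z :
  inC sigma delta x y -> inC sigma delta y z -> inC sigma delta x z.
Proof.
move=> [c [nz_c ->]] [b [nz_b ->]]; have [Uc Ub] := (F_div c nz_c, F_div b nz_b).
exists (c * b); split.
  apply/eqP => /(divring_mulf_eq0 F F_div)/(_ nz_b) c0.
  by rewrite c0 eqxx in nz_c.
by rewrite DopM invrM // [RHS]mulrA [in RHS]mulrDl (mulrK Ub) -[in RHS]mulrA.
Qed.

(** The inverse conjugator works: expand y = D_y(1) = D_y(b^-1 b) by the product rule. *)
Lemma inC_sym x y : inC sigma delta x y -> inC sigma delta y x.
Proof.
move=> [b [nz_b ->]]; have Ub := F_div b nz_b.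
exists b^-1; split; first by apply/eqP => b0; move: Ub; rewrite -unitrV b0 unitr0.
rewrite invrK -{1}[y]Dop1 -{1}(mulVr Ub) DopM.
by rewrite [RHS]mulrDl [in RHS]mulrA (mulrVK Ub).
Qed.

Section ConjugacyClasses.

Context (l : nat) (a : 'I_l -> F).
Context (a_distinct : forall i j : 'I_l, i != j ->
  ~ (forall x, inC sigma delta x (a i) <-> inC sigma delta x (a j))).

Lemma class_index_inj x i j :
  inC sigma delta x (a i) -> inC sigma delta x (a j) -> i = j.
Proof.
move=> xi xj; apply/eqP/contraT => /a_distinct[] y.
by split=> Cy; [apply: inC_trans xj | apply: inC_trans xi] => //;
   apply: (inC_trans _ _ _ Cy); apply: inC_sym.
Qed.

Lemma size_sum_nnum (S : seq F) :
  (forall x, x \in S -> exists i, inC sigma delta x (a i)) ->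
  size S = (\sum_(i < l) nnum sigma delta S a i)%N.
Proof.
move=> covS; under eq_bigr do rewrite /nnum -sum1_count big_mkcond /=.
rewrite exchange_big -sum1_size big_seq [RHS]big_seq; apply: eq_bigr => x /covS[i xi].
rewrite (bigD1 i) //= (introT (inCP _ _)) // big1 // => j ne_ji.
by case: inCP => // xj; rewrite (class_index_inj x j i) ?eqxx in ne_ji.
Qed.

(** [nn] is only pointwise equal to the class counts of [S], so that the families of two P-bases can
    share one dependent index type. *)
Definition conjugators (S : seq F) (nn : 'I_l -> nat)
    (alpha : forall i : 'I_l, 'I_(nn i) -> F) : Prop :=
  (forall i, nn i = nnum sigma delta S a i) /\
  (forall i j, alpha i j != 0 /\
     nth 0 (part sigma delta S a i) j = D (a i) (alpha i j) * (alpha i j)^-1).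

(** Lets the class sizes of two bases be compared before both are indexed by the same [nn]. *)
Lemma conjugators_exist (S : seq F) :
  exists alpha, conjugators S (nnum sigma delta S a) alpha.
Proof.
pose P i (j : 'I_(nnum sigma delta S a i)) b := b != 0 /\
  nth 0 (part sigma delta S a i) j = D (a i) b * b^-1.
have Pex i j : exists b, P i j b.
  have : nth 0 (part sigma delta S a i) j \in part sigma delta S a i.
    by rewrite mem_nth // size_filter.
  by rewrite mem_filter => /andP[/inCP].
have [alpha alphaP] := fin_all_exists (fun i => fin_all_exists (Pex i)).
by exists alpha; split.
Qed.

(** * Representatives of a P-independent set: duality, freeness and span *)

Section Family.

Context (S : seq F) (nn : 'I_l -> nat) (alpha : forall i : 'I_l, 'I_(nn i) -> F).
Context (S_uniq : uniq S) (S_cov : forall x, x \in S -> exists i, inC sigma delta x (a i)).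
Context (alphaP : conjugators S nn alpha).

Local Notation T := {i : 'I_l & 'I_(nn i)}.
Local Notation pt := (fun t : T => nth 0 (part sigma delta S a (tag t)) (tagged t)).
Local Notation al := (fun t : T => alpha (tag t) (tagged t)).

(** Passes from pairs (class, position in the class) to positions in [S]. Injectivity holds because
    classes are disjoint and [S] is duplicate-free; equal cardinals then give bijectivity. *)
Lemma pt_bij : exists2 idx : T -> 'I_(size S), bijective idx &
  forall t, nth 0 S (idx t) = pt t.
Proof.
have [nnE _] := alphaP.
have lt_size (t : T) : (tagged t < size (part sigma delta S a (tag t)))%N.
  by rewrite size_filter -/(nnum sigma delta S a (tag t)) -nnE.
have pt_in t : inCb sigma delta (pt t) (a (tag t)) && (pt t \in S).
  by rewrite -(mem_filter (fun x => inCb sigma delta x (a (tag t)))) mem_nth.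
have lt_idx t : (index (pt t) S < size S)%N by rewrite index_mem; case/andP: (pt_in t).
exists (fun t => Ordinal (lt_idx t)) => [|t]; last first.
  by rewrite /= nth_index //; case/andP: (pt_in t).
apply: inj_card_bij => [t t' [] /(congr1 (nth 0 S))|].
  have [/inCP Ct St] := andP (pt_in t); have [/inCP Ct' St'] := andP (pt_in t').
  rewrite !nth_index // => eq_pt; rewrite eq_pt in Ct.
  have eq_tag := class_index_inj _ _ _ Ct Ct'.
  (* The tags are identified first, so that [j] and [j'] have the same type. *)
  case: t t' eq_tag eq_pt {Ct Ct' St St'} => [i j] [i' j'] /= eq_i; case: i' / eq_i j'.
  move=> j' /eqP; rewrite nth_uniq ?filter_uniq //.
  - by move/eqP/val_inj ->.
  - exact: (lt_size (existT _ i j)).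
  - exact: (lt_size (existT _ i j')).
rewrite card_ord card_tagged size_sum_nnum // sumnE big_map big_enum.
by apply/eq_leq/eq_big => // i _; rewrite card_ord nnE.
Qed.

Lemma Deval_conjugators p t : Deval p (a (tag t)) (al t) = eval p (pt t) * al t.
Proof. by have [_ /(_ (tag t) (tagged t))[nz ->]] := alphaP; rewrite skew_eval_conj. Qed.

Lemma conjugators_neq0 t : al t != 0.
Proof. by have [_ /(_ (tag t) (tagged t))[]] := alphaP. Qed.

(** Scaling the dual polynomials of [S] on the left by the inverse of [al t] offsets the factor from
    [skew_eval_conj]. *)
Lemma conjugators_dual : P_independent sigma delta S ->
  exists q : T -> {poly F},
    forall t t', Deval (q t) (a (tag t')) (al t') = (t' == t)%:R.
Proof.
move=> indS; have [idx idx_bij idxE] := pt_bij.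
suff ex_q t : exists q, forall t', Deval q (a (tag t')) (al t') = (t' == t)%:R.
  exact: fin_all_exists ex_q.
have ptS t' : pt t' \in S by rewrite -idxE mem_nth.
have [q [q1 q0]] := P_dual S (pt t) indS (ptS t).
exists ((al t)^-1 *: q) => t'; rewrite DevalZ Deval_conjugators.
have [->|ne_t] := eqVneq t' t; first by rewrite q1 mul1r mulVr ?F_div ?conjugators_neq0.
rewrite q0 ?mul0r ?mulr0 //; apply/eqP; rewrite -!idxE nth_uniq //.
by rewrite val_eqE (inj_eq (bij_inj idx_bij)).
Qed.

(** Applying the dual polynomial at [j] to the relation isolates [k j], by right K-linearity. *)
Lemma conjugators_free i (k : 'I_(nn i) -> F) : P_independent sigma delta S ->
  (forall j, inK sigma delta (a i) (k j)) ->
  \sum_j alpha i j * k j = 0 -> forall j, k j = 0.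
Proof.
move=> indS Kk sum0 j; have [q qE] := conjugators_dual indS.
pose tg (j' : 'I_(nn i)) : T := existT _ i j'.
rewrite -[RHS](Deval0r (q (tg j)) (a i)) -sum0 Deval_sumr (bigD1 j) //=.
rewrite DevalMK // (qE (tg j) (tg j)) eqxx mul1r big1 ?addr0 // => j' ne_j.
rewrite DevalMK // (qE (tg j) (tg j')) (_ : tg j' == tg j = false) ?mul0r //.
by rewrite eq_Tagged; apply/negbTE.
Qed.

Lemma conjugators_span i b : P_independent sigma delta S -> b != 0 ->
  P_closure sigma delta (fun x => x \in S) (D (a i) b * b^-1) ->
  exists k : 'I_(nn i) -> F, (forall j, inK sigma delta (a i) (k j)) /\
    b = \sum_j alpha i j * k j.
Proof.
move=> indS nz_b clb; have [q qE] := conjugators_dual indS.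
have [idx [idx' _ idxK] idxE] := pt_bij.
pose mu t := Deval (q t) (a i) b.
have muE p : Deval p (a i) b = \sum_t Deval p (a (tag t)) (al t) * mu t.
  (* [p] minus its Lagrange interpolant vanishes on [S], hence at the point represented by [b]. *)
  pose r := p - \sum_t Deval p (a (tag t)) (al t) *: q t.
  have r0 t : Deval r (a (tag t)) (al t) = 0.
    rewrite DevalD DevalN Deval_sum (bigD1 t) //= DevalZ qE eqxx mulr1 big1 ?addr0 ?subrr //.
    by move=> t' ne_t; rewrite DevalZ qE eq_sym (negbTE ne_t) mulr0.
  have: Deval r (a i) b = 0.
    rewrite skew_eval_conj // clb ?mul0r // => _ /(nthP 0)[j lt_jS <-].
    have := r0 (idx' (Ordinal lt_jS)); rewrite Deval_conjugators -idxE idxK.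
    by move/(divring_mulf_eq0 F F_div)/(_ (conjugators_neq0 _)).
  rewrite DevalD DevalN Deval_sum => /eqP; rewrite subr_eq0 => /eqP ->.
  by apply: eq_bigr => t _; rewrite DevalZ.
(* Apply [muE] to x times [q t]: its value at [al t'] is D(1) = [a (tag t)] when t' = t, and D(0) =
   0 otherwise. *)
have Dmu t : D (a i) (mu t) = a (tag t) * mu t.
  rewrite -Deval_mulX muE (bigD1 t) //= Deval_mulX qE eqxx Dop1 big1 ?addr0 // => t' ne_t.
  by rewrite Deval_mulX qE (negbTE ne_t) Dop0 mul0r.
(* A nonzero [mu t] would conjugate [a i] to [a (tag t)]. *)
have mu0 t : tag t != i -> mu t = 0.
  move=> ne_i; apply/eqP; apply: contraNT ne_i => nz_mu; apply/eqP.
  apply: (class_index_inj (a (tag t))); first exact: inC_refl.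
  by exists (mu t); rewrite Dmu mulrK ?F_div.
exists (fun j => mu (existT _ i j)); split=> [j|]; first exact: Dmu.
(* The constant polynomial 1 in [muE] expands [b] itself. *)
rewrite -[LHS]mul1r -(DevalC 1 (a i)) muE.
transitivity (\sum_i' \sum_j alpha i' j * mu (existT _ i' j)).
  by rewrite sig_big_dep; apply: eq_bigr => -[i' j] _; rewrite DevalC mul1r.
rewrite (bigD1 i) //= [X in _ + X]big1 ?addr0 // => i' ne_i.
by rewrite big1 // => j _; rewrite mu0 ?mulr0.
Qed.

(** After reindexing, the map multiplies each coordinate on the right by a nonzero constant. *)
Lemma phiMap_iso n : P_independent sigma delta S -> n = size S ->
  left_iso (phiMap sigma delta S n a alpha).
Proof.
move=> indS nS; have [idx [idx' idxK idx'K] idxE] := pt_bij.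
have phiE f t : phiMap sigma delta S n a alpha f t = f (idx t) * al t.
  by rewrite ffunE Deval_conjugators -idxE -[in RHS](InterpK S n f) // [in RHS]ffunE.
split=> [c u v|]; first by apply/ffunP=> t; rewrite [RHS]ffunE !phiE ffunE mulrDl mulrA.
exists (fun g : {ffun T -> F} => [ffun k => g (idx' k) * (al (idx' k))^-1]) => g;
  apply/ffunP=> k.
  by rewrite ffunE phiE idx'K mulrK ?F_div ?conjugators_neq0.
by rewrite phiE ffunE idxK mulrVK ?F_div ?conjugators_neq0.
Qed.

End Family.

(** * Change of P-basis *)

Section Transition.

Context (Omega : F -> Prop).

(** The matrices are rectangular here, since equality of the class sizes is deduced from them. *)
Lemma transition_mx (S S' : seq F) (nn nn' : 'I_l -> nat)
    (alpha : forall i, 'I_(nn i) -> F) (alpha' : forall i, 'I_(nn' i) -> F) :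
  P_basis sigma delta Omega S -> P_basis sigma delta Omega S' ->
  (forall x, x \in S -> exists i, inC sigma delta x (a i)) ->
  conjugators S nn alpha -> conjugators S' nn' alpha' ->
  exists M : forall i, 'M[F]_(nn i, nn' i),
    forall i, (forall j k, inK sigma delta (a i) (M i j k)) /\
      forall k, alpha' i k = \sum_j alpha i j * M i j k.
Proof.
move=> [_ indS clS] [subS' _ _] covS cS [nnE' cS'].
suff exM i : exists M : 'M[F]_(nn i, nn' i),
    (forall j k, inK sigma delta (a i) (M j k)) /\
    forall k, alpha' i k = \sum_j alpha i j * M j k.
  by have [M MP] := fin_all_exists exM; exists M.
have ex_col k : exists m : 'I_(nn i) -> F,
    (forall j, inK sigma delta (a i) (m j)) /\ alpha' i k = \sum_j alpha i j * m j.
  have [nz_k pt_k] := cS' i k.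
  apply: (conjugators_span S nn alpha (proj1 indS) covS cS) => //.
  rewrite -pt_k; apply/clS/subS'.
  have: nth 0 (part sigma delta S' a i) k \in part sigma delta S' a i.
    by rewrite mem_nth // size_filter -/(nnum sigma delta S' a i) -nnE'.
  by rewrite mem_filter => /andP[].
have [m mP] := fin_all_exists ex_col.
exists (\matrix_(j, k) m k j); split=> [j k|k]; first by rewrite mxE; have [] := mP k.
by have [_ ->] := mP k; apply: eq_bigr => j _; rewrite mxE.
Qed.

(** Substituting one expansion into the other gives alpha (M N - 1) = 0; the entries lie in K, so
    freeness of alpha kills each column. *)
Lemma transition_mulmx (S : seq F) (nn nn' : 'I_l -> nat)
    (alpha : forall i, 'I_(nn i) -> F) (alpha' : forall i, 'I_(nn' i) -> F)
    i (M : 'M[F]_(nn i, nn' i)) (N : 'M[F]_(nn' i, nn i)) :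
  P_independent sigma delta S ->
  (forall x, x \in S -> exists i, inC sigma delta x (a i)) ->
  conjugators S nn alpha ->
  (forall j k, inK sigma delta (a i) (M j k)) ->
  (forall j k, inK sigma delta (a i) (N j k)) ->
  (forall k, alpha' i k = \sum_j alpha i j * M j k) ->
  (forall k, alpha i k = \sum_j alpha' i j * N j k) ->
  M *m N = 1%:M.
Proof.
move=> indS covS cS KM KN ME NE; apply/matrixP=> j k; apply/eqP; rewrite -subr_eq0.
apply/eqP; move: j; apply: (conjugators_free S nn alpha (proj1 indS) covS cS i) => // [j|].
  apply: inKD; last first.
    by apply: inKN; rewrite mxE; case: eqP => _; [apply: inK1 | apply: inK0].
  rewrite mxE; elim/big_ind: _ => [|x y|j' _]; [exact: inK0 | exact: inKD |].
  exact: inKM.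
under eq_bigr do rewrite mulrBr.
rewrite sumrB; apply/eqP; rewrite subr_eq0; apply/eqP.
transitivity (alpha i k).
  rewrite NE; under [RHS]eq_bigr do rewrite ME mulr_suml.
  rewrite exchange_big; apply: eq_bigr => j _; rewrite mxE mulr_sumr.
  by apply: eq_bigr => k' _; rewrite mulrA.
rewrite (bigD1 k) //= mxE eqxx mulr1 big1 ?addr0 // => j ne_jk.
by rewrite mxE (negbTE ne_jk) mulr0.
Qed.

Lemma piM_comp (nn : 'I_l -> nat) (M N : forall i, 'M[F]_(nn i)) c :
  (forall i, M i *m N i = 1%:M) -> piM N (piM M c) = c.
Proof.
move=> MN1; apply/ffunP=> -[i k]; rewrite ffunE /=.
under eq_bigr do rewrite ffunE mulr_suml /=.
rewrite exchange_big /= (bigD1 k) //= [X in _ + X]big1 => [|j ne_jk].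
  under eq_bigr do rewrite -mulrA.
  rewrite -mulr_sumr; have := congr1 (fun A : 'M_(nn i) => A k k) (MN1 i).
  by rewrite !mxE eqxx => ->; rewrite mulr1 addr0.
under eq_bigr do rewrite -mulrA.
rewrite -mulr_sumr; have := congr1 (fun A : 'M_(nn i) => A j k) (MN1 i).
by rewrite !mxE (negbTE ne_jk) => ->; rewrite mulr0.
Qed.

Lemma piM_iso (nn : 'I_l -> nat) (M N : forall i, 'M[F]_(nn i)) :
  (forall i, M i *m N i = 1%:M) -> (forall i, N i *m M i = 1%:M) -> left_iso (piM M).
Proof.
move=> MN NM; split=> [c u v|]; last by exists (piM N) => c; apply: piM_comp.
apply/ffunP=> t; rewrite !ffunE mulr_sumr -big_split; apply: eq_bigr => j _.
by rewrite ffunE mulrDl mulrA.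
Qed.

Lemma nnum_leq (S S' : seq F) i :
  P_basis sigma delta Omega S -> P_basis sigma delta Omega S' ->
  (forall x, x \in S -> exists i, inC sigma delta x (a i)) ->
  (forall x, x \in S' -> exists i, inC sigma delta x (a i)) ->
  (nnum sigma delta S a i <= nnum sigma delta S' a i)%N.
Proof.
move=> bS bS' covS covS'.
have [[alpha cS] [alpha' cS']] := (conjugators_exist S, conjugators_exist S').
have [M /(_ i)[KM ME]] := transition_mx _ _ _ _ _ _ bS bS' covS cS cS'.
have [N /(_ i)[KN NE]] := transition_mx _ _ _ _ _ _ bS' bS covS' cS' cS.
have [_ indS _] := bS.
exact: (mulmx1_leq F F_div _ _
  (transition_mulmx _ _ _ _ _ _ _ _ indS covS cS KM KN ME NE)).
Qed.

Lemma phiMap_transition (S S' : seq F) (nn : 'I_l -> nat) n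
    (alpha beta : forall i, 'I_(nn i) -> F) (M : forall i, 'M[F]_(nn i)) f :
  P_independent sigma delta S' -> n = size S' ->
  (forall x, x \in S' -> exists i, inC sigma delta x (a i)) ->
  conjugators S' nn beta ->
  (forall i j k, inK sigma delta (a i) (M i j k)) ->
  (forall i k, beta i k = \sum_j alpha i j * M i j k) ->
  phiMap sigma delta S' n a beta (piAB sigma delta S S' n f) =
  piM M (phiMap sigma delta S n a alpha f).
Proof.
move=> indS' nS' covS' cS' KM ME; apply/ffunP=> t.
have [idx _ idxE] := pt_bij S' nn beta (proj1 indS') covS' cS'.
rewrite !ffunE (Deval_conjugators S' nn beta cS') -idxE.
(* The interpolants on [S] and on [S'] agree at the points of [S'], so the first can be evaluated at
   [beta]. *)
have /ffunP/(_ (idx t)) := InterpK S' n (piAB sigma delta S S' n f) indS' nS'.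
rewrite [in LHS]ffunE => ->; rewrite ffunE idxE -(Deval_conjugators S' nn beta cS').
rewrite ME Deval_sumr; apply: eq_bigr => j _.
by rewrite DevalMK // ffunE.
Qed.

End Transition.

End ConjugacyClasses.

End SkewEvaluation.

Theorem mainTheorem9 (F : unitRingType)
  (F_div : forall x : F, x != 0 -> x \is a GRing.unit)
  (sigma : {rmorphism F -> F}) (delta : F -> F)
  (delta_add : forall x y : F, delta (x + y) = delta x + delta y)
  (delta_mul : forall x y : F, delta (x * y) = sigma x * delta y + delta x * y)
  (Omega : F -> Prop) (A B : seq F)
  (HOmega : P_closed sigma delta Omega)
  (HA : P_basis sigma delta Omega A) (HB : P_basis sigma delta Omega B)
  (l : nat) (a : 'I_l -> F)
  (Hdist : forall i j : 'I_l, i != j ->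
     ~ (forall x, inC sigma delta x (a i) <-> inC sigma delta x (a j)))
  (HAne : forall i : 'I_l, exists x, x \in A /\ inC sigma delta x (a i))
  (HBne : forall i : 'I_l, exists x, x \in B /\ inC sigma delta x (a i))
  (HAcov : forall x, x \in A -> exists i : 'I_l, inC sigma delta x (a i))
  (HBcov : forall x, x \in B -> exists i : 'I_l, inC sigma delta x (a i)) :
  let n := size A in
  let nn := nnum sigma delta A a in
  (forall i : 'I_l, nn i = nnum sigma delta B a i) /\
  n = (\sum_(i < l) nn i)%N /\
  forall alpha beta : forall i : 'I_l, 'I_(nn i) -> F,
    (forall (i : 'I_l) (j : 'I_(nn i)), alpha i j != 0 /\
       nth 0 (part sigma delta A a i) j = Dop sigma delta (a i) (alpha i j) * (alpha i j)^-1) ->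
    (forall (i : 'I_l) (j : 'I_(nn i)), beta i j != 0 /\
       nth 0 (part sigma delta B a i) j = Dop sigma delta (a i) (beta i j) * (beta i j)^-1) ->
    exists M : forall i : 'I_l, 'M[F]_(nn i),
      (forall i : 'I_l,
         (forall j k, inK sigma delta (a i) (M i j k)) /\
         exists N : 'M[F]_(nn i), (forall j k, inK sigma delta (a i) (N j k)) /\
            M i *m N = 1%:M /\ N *m M i = 1%:M) /\
      (forall (i : 'I_l) (k : 'I_(nn i)), beta i k = \sum_(j < nn i) alpha i j * M i j k) /\
      left_iso (phiMap sigma delta A n a alpha) /\
      left_iso (phiMap sigma delta B n a beta) /\
      left_iso (piAB sigma delta A B n) /\
      left_iso (piM M) /\
      (forall f, phiMap sigma delta B n a beta (piAB sigma delta A B n f)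
                 = piM M (phiMap sigma delta A n a alpha f)).
Proof.
move=> n nn; have nnE i : nn i = nnum sigma delta B a i.
  by apply/eqP; rewrite eqn_leq; apply/andP; split;
     apply: (nnum_leq F F_div sigma delta delta_add delta_mul l a Hdist Omega).
have nE : n = (\sum_(i < l) nn i)%N.
  exact: size_sum_nnum.
(* Both bases have the same length because their class sizes agree. *)
have nB : n = size B.
  rewrite nE (eq_bigr _ (fun i _ => nnE i)) -size_sum_nnum //.
split=> //; split=> // alpha beta alphaP betaP.
have cA : conjugators F sigma delta l a A nn alpha by split.
have cB : conjugators F sigma delta l a B nn beta by split.
have [_ indA _] := HA; have [_ indB _] := HB.
have [M MP] := transition_mx F F_div sigma delta delta_add delta_mul l a Hdist Omega
  A B nn nn alpha beta HA HB HAcov cA cB.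
have [N NP] := transition_mx F F_div sigma delta delta_add delta_mul l a Hdist Omega
  B A nn nn beta alpha HB HA HBcov cB cA.
have [MN NM] : (forall i, M i *m N i = 1%:M) /\ (forall i, N i *m M i = 1%:M).
  split=> i; have [[KM ME] [KN NE]] := (MP i, NP i).
    exact: (transition_mulmx F F_div sigma delta delta_add delta_mul l a Hdist
      A nn nn alpha beta).
  exact: (transition_mulmx F F_div sigma delta delta_add delta_mul l a Hdist
    B nn nn beta alpha).
exists M; split=> [i|]; last split=> [i k|].
- by split=> [|]; [case: (MP i) | exists (N i); split=> //; case: (NP i)].
- by have [_] := MP i.
split; first by apply: (phiMap_iso F F_div sigma delta delta_add delta_mul l a Hdist
  A nn alpha (proj1 indA)).
split; first by apply: (phiMap_iso F F_div sigma delta delta_add delta_mul l a Hdist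
  B nn beta (proj1 indB)).
split; first exact: (piAB_iso F F_div sigma delta delta_add delta_mul Omega).
split=> [|f]; first exact: (piM_iso _ _ _ M N).
apply: (phiMap_transition F F_div sigma delta delta_add delta_mul) => // i.
  by case: (MP i).
by case: (MP i).
Qed.
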